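(* Let $M_{\mathcal{B}}$ be a rational multicyclic monoid over $\mathcal{B}$ such that no element of $\mathcal{B}$ is a unit fraction, and let $n$ be a nonnegative integer. The following statements hold: (1) $M_{\mathcal{B}}$ is hereditarily atomic if and only if $\mathsf{n}(b) \geq \mathsf{d}(b)$ for all $b \in \mathcal{B}$. (2) There are infinitely many pairwise non-isomorphic non-atomic rational multicyclic monoids having exactly $n$ proper fractions as primitive generators (that is, monoids of the form $M_{\mathcal{C}}$ where $M_{\mathcal{C}}$ is the rational multicyclic monoid over $\mathcal{C}$, no element of $\mathcal{C}$ is a unit fraction, and exactly $n$ elements of $\mathcal{C}$ are proper fractions) if and only if $n \geq 2$.
   Context: $\mathbb{N}$ and $\mathbb{N}_0$ are the positive and nonnegative integers. For $q \in \mathbb{Q}_{>0}$, $\mathsf{n}(q)$ and $\mathsf{d}(q)$ are the relatively prime positive integers with $q = \mathsf{n}(q)/\mathsf{d}(q)$. A positive fraction is proper if it is $<1$. A unit fraction is a number $1/m$ with $m \in \mathbb{N}$, $m > 1$. A Puiseux monoid is an additive submonoid of $\mathbb{Q}_{\geq 0}$; all such monoids are reduced (the only invertible element is $0$). An atom of a reduced commutative monoid $M$ (written additively) is a nonzero element that is not a sum of two nonzero elements of $M$; $\mathcal{A}(M)$ is the set of atoms. $\langle S\rangle$ is the submonoid generated by $S$. $M$ is atomic if $M = \langle \mathcal{A}(M)\rangle$, and hereditarily atomic if every submonoid of $M$ is atomic. For a finite subset $\mathcal{B} \subseteq \mathbb{Q}_{>0}$, set $M_{\mathcal{B}} := \langle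 b^k \mid b \in \mathcal{B},\, k \in \mathbb{N}_0\rangle$ (so $M_\emptyset=\{0\}$). $M_{\mathcal{B}}$ is called the rational multicyclic monoid over $\mathcal{B}$ if $\mathcal{B}$ is minimal, i.e. $M_{\mathcal{B}'} \subsetneq M_{\mathcal{B}}$ whenever $\mathcal{B}' \subsetneq \mathcal{B}$; the elements of such a minimal $\mathcal{B}$ are called primitive generators. *)

(* Defs.v *)
From mathcomp Require Import all_boot all_order all_algebra finmap.
From mathcomp Require Import boolp classical_sets functions cardinality.

Set Implicit Arguments.
Unset Strict Implicit.
Unset Printing Implicit Defensive.

Import Order.TTheory GRing.Theory Num.Theory.

Local Open Scope classical_set_scope.
Local Open Scope ring_scope.

Section Monoids.
Variable V : nmodType.
Implicit Types S M N : set V.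

Definition submonoid M : Prop :=
  M 0 /\ forall x y, M x -> M y -> M (x + y).

Definition gen_submonoid S : set V := smallest submonoid S.

(* This is the notion of atom for reduced monoids; every submonoid of the
   nonnegative rationals is reduced. *)
Definition atoms M : set V :=
  [set a | [/\ M a, a <> 0 &
    ~ exists x y, [/\ M x, M y, x <> 0, y <> 0 & a = x + y]]].

Definition atomic M : Prop := M = gen_submonoid (atoms M).

Definition hereditarily_atomic M : Prop :=
  forall N, submonoid N -> N `<=` M -> atomic N.

End Monoids.

(* Isomorphism of submonoids M of V and N of W: only the restriction of f to M
   matters. *)
Definition monoid_isomorphic (V W : nmodType) (M : set V) (N : set W) : Prop :=
  exists f : V -> W, [/\ set_bij M N f, f 0 = 0 &
    forall x y, M x -> M y -> f (x + y) = f x + f y].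

Definition unit_fraction (q : rat) : Prop :=
  exists m : nat, (1 < m)%N /\ q = m%:R^-1.

Definition proper_fraction (q : rat) : bool := 0 < q < 1.

Definition multicyclic (B : {fset rat}) : set rat :=
  gen_submonoid [set x | exists b k, b \in B /\ x = b ^+ k].

(* B is a minimal finite set of positive rationals, so that multicyclic B is
   the rational multicyclic monoid over B and the elements of B are its
   primitive generators. *)
Definition primitive_generators (B : {fset rat}) : Prop :=
  (forall b, b \in B -> 0 < b) /\
  (forall B' : {fset rat}, (B' `<` B)%fset ->
     multicyclic B' `<` multicyclic B).

Definition nonatomic_multicyclic (n : nat) : set (set rat) :=
  [set M | ~ atomic M /\
    exists C : {fset rat},
      [/\ M = multicyclic C, primitive_generators C,
          forall c, c \in C -> ~ unit_fraction c &
          #|` [fset c in C | proper_fraction c]%fset| = n]].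

Definition infinitely_many_nonisomorphic (V : nmodType)
    (P : set (set V)) : Prop :=
  exists F : set (set V),
    [/\ F `<=` P, infinite_set F &
        forall M N, F M -> F N -> M <> N -> ~ monoid_isomorphic M N].

(* Main.v *)
(* Write [b = a / d] in lowest terms for a proper fraction [b] that is not a unit
   fraction, so that [1 < a].

   The elements [x_k = 1 + d b^k] and [y_k = (d - a) b^k], for [k >= 1], satisfy
   [x_k = x_{k+1} + y_k] because [d b^(k+1) = a b^k].  Hence in the submonoid
   that they generate every atom is some [y_k], which is divisible by [a] in
   [Z_(a)], whereas [x_1 = 1 + a] is not: this submonoid is not atomic.  When all
   the generators are at least [1], the nonzero elements are at least [1], which
   forces atomicity.

   If [b] is the only proper fraction, its powers are atoms by divisibility by
   [a], and below any bound there are finitely many powers of the other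
   generators, so the monoid is atomic.

   For [n >= 2], take the generators [2 / p], [3 / p] with [p > 36] prime, and
   [6 / e] for [n - 2] fixed primes [e] between [6] and [p].  The numerators keep
   [2 / p] and [3 / p] primitive, by divisibility by [3] and by [2], and the
   denominators keep the [6 / e] primitive.  As [36^k <= p^k], the integer [p^k]
   is a combination of [4^k] and [9^k] with coefficients in the natural numbers,
   so the monoid contains [1 / p^k] for all [k].  Hence no power of [2 / p] or
   [3 / p] is an atom, and the atoms cannot generate [1 / p].  Moreover [1] is
   divisible by all the powers of [p], which distinguishes these monoids up to
   isomorphism when [p] varies. *)
Require Import Defs.
From mathcomp Require Import all_boot all_order all_algebra finmap.
From mathcomp Require Import boolp classical_sets functions cardinality.
From mathcomp Require Import ring lra zify.
Set Implicit Arguments.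
Unset Strict Implicit.
Unset Printing Implicit Defensive.

Import Order.TTheory GRing.Theory Num.Theory.

Local Open Scope ring_scope.
Local Open Scope classical_set_scope.

(** * Generated submonoids *)

Section Submonoids.
Variable V : nmodType.
Implicit Types S M : set V.

Lemma sub_gen_submonoid S : S `<=` gen_submonoid S.
Proof. exact: sub_gen_smallest. Qed.

Lemma gen_submonoid_sub S M : submonoid M -> S `<=` M -> gen_submonoid S `<=` M.
Proof. by move=> hM hS; apply: smallest_sub. Qed.

Lemma gen_submonoid_submonoid S : submonoid (gen_submonoid S).
Proof.
split=> [M [[] //]|x y hx hy M [hM hS]].
by apply: hM.2; [apply: hx|apply: hy].
Qed.

Lemma submonoidMn M x n : submonoid M -> M x -> M (x *+ n).
Proof.
move=> [h0 hD] hx; elim: n => [|n IHn]; first by rewrite mulr0n.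
by rewrite mulrS; apply: hD.
Qed.

(** The elements with such a decomposition form a submonoid containing [S]. Splitting off a nonzero
    generator is what forces every atom to be a generator. *)
Lemma gen_submonoid_head S x : gen_submonoid S x ->
  x = 0 \/ exists g y, [/\ S g, gen_submonoid S y, g <> 0 & x = g + y].
Proof.
have [g0 gD] := gen_submonoid_submonoid S.
(* Membership in [gen_submonoid S] is carried along, because the remainder [y + v] of a sum must
   stay in it. *)
pose T : set V := [set x | gen_submonoid S x /\ (x = 0 \/
  exists g y, [/\ S g, gen_submonoid S y, g <> 0 & x = g + y])].
suff hT : gen_submonoid S `<=` T by move=> /hT [].
apply: gen_submonoid_sub.
  split; first by split; [|left].
  move=> u v [hu hu'] [hv hv']; split; first exact: gD.
  case: hu' => [->|[g [y [hg hy g_neq0 ->]]]]; first by rewrite add0r.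
  right; exists g, (y + v); split => //; first exact: gD.
  by rewrite addrA.
move=> g hg; split; first exact: sub_gen_submonoid.
have [->|/eqP g_neq0] := eqVneq g 0; first by left.
by right; exists g, 0; split; rewrite ?addr0.
Qed.

Lemma atoms_gen_submonoid S : atoms (gen_submonoid S) `<=` S.
Proof.
move=> x [hx x_neq0 x_irr].
have [//|[g [y [hg hy g_neq0 xE]]]] := gen_submonoid_head hx.
have [y0|/eqP y_neq0] := eqVneq y 0; first by rewrite xE y0 addr0.
by case: x_irr; exists g, y; split => //; apply: sub_gen_submonoid.
Qed.

Lemma atomicP M : submonoid M ->
  (forall x, M x -> gen_submonoid (atoms M) x) -> atomic M.
Proof.
move=> hM h; apply/seteqP; split => //.
by apply: gen_submonoid_sub => // x [].
Qed.

End Submonoids.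

(* The summands of an element of a submonoid of the nonnegative rationals are
   not larger than this element. *)
Lemma gen_submonoid_lt (S T : set rat) (r : rat) : submonoid T ->
  (forall g, S g -> 0 <= g /\ (g < r -> T g)) ->
  forall x, gen_submonoid S x -> 0 <= x /\ (x < r -> T x).
Proof.
move=> [T0 TD] hS.
apply: (@gen_submonoid_sub _ _ [set x | 0 <= x /\ (x < r -> T x)]) => //.
split => //= x y [x_ge0 hx] [y_ge0 hy]; split; first exact: addr_ge0.
by move=> lt_r; apply: TD; [apply: hx|apply: hy]; lra.
Qed.

(** Induction on an integer bound: if [x < n + 1] splits into two nonzero elements, both are at
    least 1, so both are below [n]. *)
Lemma atomic_ge1 (M : set rat) : submonoid M ->
  (forall x, M x -> x = 0 \/ 1 <= x) -> atomic M.
Proof.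
move=> hM M_ge1; apply: atomicP => // x hx.
have [gen0 genD] := gen_submonoid_submonoid (atoms M).
have [n] : exists n, x < n%:R by exists (Num.truncn x).+1; exact: truncnS_gt.
 elim: n => [|n IHn] in x hx *.
  by have [->|] := M_ge1 _ hx => //; lra.
move=> x_lt; have [-> //|x_ge1] := M_ge1 _ hx.
have [x_atom|x_natom] := EM (atoms M x); first exact: sub_gen_submonoid.
apply: contrapT => gx; apply: x_natom; split => //; first by move=> x0; lra.
move=> [y [z [hy hz y_neq0 z_neq0 xE]]]; apply: gx.
have [//|y_ge1] := M_ge1 _ hy; have [//|z_ge1] := M_ge1 _ hz.
move: x_lt; rewrite -natr1 xE => x_lt.
by apply: genD; apply: IHn => //; lra.
Qed.

(** * Divisibility by powers of an integer in the rationals *)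

(* The ideal [m ^ k Z_(m)] of the ring of fractions whose denominator is coprime
   to [m]. *)
Definition local_ideal (m k : nat) : set rat :=
  [set x | exists v, coprime m v /\
    exists z : int, v%:R * x = (m ^ k)%:R * z%:~R].

Lemma local_ideal_submonoid m k : submonoid (local_ideal m k).
Proof.
split.
  exists 1%N; split; first exact: coprimen1.
  by exists 0; rewrite mulr0 mulr0.
move=> x y [v [cv [z hz]]] [w [cw [t ht]]]; exists (v * w)%N.
split; first by rewrite coprimeMr cv.
exists (w%:Z * z + v%:Z * t).
rewrite natrM intrD !intrM.
have -> : v%:R * w%:R * (x + y) = w%:R * (v%:R * x) + v%:R * (w%:R * y) by ring.
by rewrite hz ht; ring.
Qed.

Lemma local_idealM m k l x y :
  local_ideal m k x -> local_ideal m l y -> local_ideal m (k + l) (x * y).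
Proof.
move=> [v [cv [z hz]]] [w [cw [t ht]]]; exists (v * w)%N.
split; first by rewrite coprimeMr cv.
exists (z * t); rewrite natrM expnD natrM intrM.
have -> : v%:R * w%:R * (x * y) = (v%:R * x) * (w%:R * y) by ring.
by rewrite hz ht; ring.
Qed.

Lemma local_idealX m k n x :
  local_ideal m k x -> local_ideal m (k * n) (x ^+ n).
Proof.
move=> hx; elim: n => [|n IHn]; last by rewrite mulnS exprS; apply: local_idealM.
by rewrite muln0; exists 1%N; split; [exact: coprimen1|exists 1; rewrite expn0].
Qed.

Lemma local_ideal_le m k l : (k <= l)%N -> local_ideal m l `<=` local_ideal m k.
Proof.
move=> le_kl x [v [cv [z hz]]]; exists v; split => //.
exists ((m ^ (l - k))%N%:Z * z).
by rewrite hz intrM -pmulrn mulrA -natrM -expnD subnKC.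
Qed.

Lemma local_ideal_fracP m k a v : (0 < v)%N ->
  local_ideal m k (a%:R / v%:R) <->
  exists w, coprime m w /\ (m ^ k * v %| w * a)%N.
Proof.
move=> v_gt0; have v_neq0 : v%:R != 0 :> rat by rewrite pnatr_eq0 -lt0n.
split=> -[w [cw]].
  move=> [z hz]; exists w; split=> //; apply/dvdnP; exists `|z|%N.
  have : (w * a)%N%:Z = (m ^ k * v)%N%:Z * z.
    apply: (@intr_inj rat); rewrite intrM -!pmulrn !natrM.
    have -> : (w%:R * a%:R : rat) = (w%:R * (a%:R / v%:R)) * v%:R by field.
    by rewrite hz; ring.
  by move=> /(congr1 absz) /=; rewrite abszM [RHS]mulnC.
move=> /dvdnP [q hq]; exists w; split=> //; exists q%:Z.
rewrite mulrA -natrM hq -pmulrn !natrM; field; exact: v_neq0.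
Qed.

Lemma local_ideal_frac m k a v : (0 < v)%N -> coprime m v -> (m ^ k %| a)%N ->
  local_ideal m k (a%:R / v%:R).
Proof.
move=> v_gt0 cv ma; apply/local_ideal_fracP => //; exists v; split=> //.
by rewrite [(v * a)%N]mulnC dvdn_mul.
Qed.

Lemma local_ideal_frac_dvdn m k a v : (0 < v)%N ->
  local_ideal m k (a%:R / v%:R) -> (m ^ k %| a)%N.
Proof.
move=> v_gt0 /local_ideal_fracP-/(_ v_gt0) [w [cw dv]].
rewrite -(@Gauss_dvdr _ w) ?coprimeXl //.
by apply: dvdn_trans dv; apply: dvdn_mulr.
Qed.

(** Exponent 0 gives the ring [Z_(m)] itself, which contains no fraction in lowest terms with
    denominator [m > 1]. *)
Lemma local_ideal_den m a : (0 < m)%N -> coprime m a ->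
  local_ideal m 0 (a%:R / m%:R) -> m = 1%N.
Proof.
move=> m_gt0 ca /local_ideal_fracP-/(_ m_gt0) [w [cw]].
rewrite expn0 mul1n Gauss_dvdr // => /gcdn_idPl ma.
by apply/eqP; rewrite -[m in m == _]ma.
Qed.

Lemma frac_nat (q : rat) : 0 <= q ->
  exists a d : nat, [/\ (0 < d)%N, coprime a d & q = a%:R / d%:R].
Proof.
move=> q_ge0; exists `|numq q|%N, `|denq q|%N.
split; rewrite ?absz_gt0 ?denq_eq0 //.
  exact: coprime_num_den.
by rewrite -[LHS]divq_num_den !pmulrn !gez0_abs ?denq_ge0 ?numq_ge0.
Qed.

Lemma local_ideal_eq0 m x : (1 < m)%N -> 0 <= x ->
  (forall k, local_ideal m k x) -> x = 0.
Proof.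
move=> m_gt1 /frac_nat [a [d [d_gt0 _ ->]]] hx.
have [->|a_gt0] := posnP a; first by rewrite mul0r.
(* The exponent [k = a] suffices, since [a < m ^ a]. *)
have /(dvdn_leq a_gt0) := local_ideal_frac_dvdn d_gt0 (hx a).
by rewrite leqNgt ltn_expl.
Qed.

(** * Monoids with at most one proper fraction *)

Lemma multicyclic_submonoid (B : {fset rat}) : submonoid (multicyclic B).
Proof. exact: gen_submonoid_submonoid. Qed.

Lemma multicyclicX (B : {fset rat}) b k : b \in B -> multicyclic B (b ^+ k).
Proof. by move=> hb; apply: sub_gen_submonoid; exists b, k. Qed.

Lemma multicyclic_sub (B : {fset rat}) (T : set rat) : submonoid T ->
  (forall b k, b \in B -> T (b ^+ k)) -> multicyclic B `<=` T.
Proof.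
by move=> hT h; apply: gen_submonoid_sub => // _ [b [k [hb ->]]]; exact: h.
Qed.

(** Only powers below [r] can be summands of an element below [r]; this lets a size bound discard
    generators before a divisibility argument. *)
Lemma multicyclic_lt (B : {fset rat}) (T : set rat) (r : rat) : submonoid T ->
  (forall b, b \in B -> 0 <= b) ->
  (forall b k, b \in B -> b ^+ k < r -> T (b ^+ k)) ->
  forall x, multicyclic B x -> x < r -> T x.
Proof.
move=> hT B_ge0 h x hx.
apply: (gen_submonoid_lt hT _ hx).2 => _ [b [k [hb ->]]].
by split; [rewrite exprn_ge0 ?B_ge0|exact: h].
Qed.

Lemma multicyclic_ge0 (B : {fset rat}) x : (forall b, b \in B -> 0 <= b) ->
  multicyclic B x -> 0 <= x.
Proof.
move=> B_ge0; move: x; apply: multicyclic_sub.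
  by split=> //= x y; apply: addr_ge0.
by move=> b k hb /=; rewrite exprn_ge0 ?B_ge0.
Qed.

Lemma hereditarily_atomic_multicyclic (B : {fset rat}) :
  (forall b, b \in B -> 1 <= b) -> hereditarily_atomic (multicyclic B).
Proof.
move=> B_ge1 N hN NM; apply: atomic_ge1 => // x /NM; move: x.
apply: multicyclic_sub; last by move=> b k hb; right; rewrite exprn_ege1 ?B_ge1.
split; first by left.
by move=> x y [->|hx] [->|hy]; rewrite ?addr0 ?add0r;
  [left|right|right|right; lra].
Qed.

(** * Nonatomic submonoids from a proper fraction *)

Lemma proper_frac_nat (b : rat) : proper_fraction b -> ~ unit_fraction b ->
  exists a d : nat, [/\ (1 < a)%N, (a < d)%N, coprime a d & b = a%:R / d%:R].
Proof.
move=> /andP [b_gt0 b_lt1] b_nunit.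
have [a [d [d_gt0 cad bE]]] := frac_nat (ltW b_gt0); exists a, d.
have lt_ad : (a < d)%N.
  by move: b_lt1; rewrite bE ltr_pdivrMr ?ltr0n // mul1r ltr_nat.
split=> //; case: a => [|[|//]] in cad bE lt_ad *.
  by move: b_gt0; rewrite bE mul0r ltxx.
by case: b_nunit; exists d; split=> //; rewrite bE mul1r.
Qed.

Lemma nonatomic_submonoid_frac (a d : nat) (b := a%:R / d%:R : rat) (M : set rat) :
  (1 < a)%N -> (a < d)%N -> coprime a d -> submonoid M ->
  (forall k, M (b ^+ k)) -> exists N, [/\ submonoid N, N `<=` M & ~ atomic N].
Proof.
move=> a_gt1 lt_ad cad hM Mb.
have d_gt0 : (0 < d)%N by lia.
have d_neq0 : d%:R != 0 :> rat by rewrite pnatr_eq0 -lt0n.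
have b_gt0 : 0 < b by rewrite divr_gt0 ?ltr0n //; lia.
(* Indices are shifted by one: [x 0] is [1 + d b = 1 + a], and every [y k] contains a positive power
   of [b], hence a factor [a]. *)
have dbS k : b ^+ k.+1 *+ d = b ^+ k *+ a.
  by rewrite -(mulr_natr (b ^+ _.+1)) -(mulr_natr (b ^+ k)) exprSr /b; field.
pose x k := 1 + b ^+ k.+1 *+ d; pose y k := b ^+ k.+1 *+ (d - a).
have xS k : x k = x k.+1 + y k.
  by rewrite /x /y (dbS k.+1) -addrA -mulrnDr subnKC // ltnW.
have x_gt0 k : 0 < x k by rewrite ltr_wpDr // mulrn_wge0 // exprn_ge0 // ltW.
have y_gt0 k : 0 < y k by rewrite pmulrn_rgt0 ?subn_gt0 ?exprn_gt0.
pose S : set rat := [set u | exists k, u = x k \/ u = y k].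
exists (gen_submonoid S); split; first exact: gen_submonoid_submonoid.
  apply: gen_submonoid_sub => // _ [k [->|->]]; last exact: submonoidMn.
  by apply: hM.2; [have := Mb 0%N; rewrite expr0|exact: submonoidMn].
move=> N_atomic.
have [La0 LaD] := local_ideal_submonoid a 1.
have hb : local_ideal a 1 b by apply: local_ideal_frac; rewrite // expn1.
(* Otherwise [a] would divide [1 + a], against [1 < a]. *)
suff : local_ideal a 1 (x 0%N).
  rewrite /x dbS expr0 -[1 + _]mulrS -[_ *+ _]divr1.
  move=> /(@local_ideal_frac_dvdn _ _ _ 1 isT).
  by rewrite expn1 -addn1 dvdn_addr // dvdn1; lia.
suff : gen_submonoid S `<=` local_ideal a 1.
  by apply; apply: sub_gen_submonoid; exists 0%N; left.
rewrite N_atomic; apply: gen_submonoid_sub => // u u_atom.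
have [k [uE|->]] := atoms_gen_submonoid u_atom; last first.
  apply: submonoidMn => //; apply: (@local_ideal_le _ _ (1 * k.+1)) => //.
  exact: local_idealX.
case: u_atom => _ _ []; exists (x k.+1), (y k); split.
- by apply: sub_gen_submonoid; exists k.+1; left.
- by apply: sub_gen_submonoid; exists k; right.
- by apply/eqP; rewrite gt_eqF.
- by apply/eqP; rewrite gt_eqF.
- by rewrite uE xS.
Qed.

(** * Atomicity with a single proper fraction *)

Lemma expr_ge_bound (c K : rat) : 1 < c ->
  exists J, forall j, (J <= j)%N -> K <= c ^+ j.
Proof.
move=> c_gt1; have bernoulli j : j%:R * (c - 1) <= c ^+ j.
  elim: j => [|j IHj]; first by rewrite mul0r expr0.
  have cj_ge1 : 1 <= c ^+ j by rewrite exprn_ege1 // ltW.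
  rewrite exprS -natr1; nra.
exists (Num.truncn (K / (c - 1))).+1 => j le_Jj.
apply: le_trans (bernoulli j); rewrite -ler_pdivrMr ?subr_gt0 //.
apply/ltW/(lt_le_trans (truncnS_gt _)).
by rewrite ler_nat.
Qed.

Lemma finite_powers_lt (s : seq rat) (K : rat) : exists t : seq rat,
  forall c j, c \in s -> 1 < c -> c ^+ j < K -> c ^+ j \in t.
Proof.
elim: s => [|c s [t ht]]; first by exists [::].
have [c_gt1|c_le1] := ltrP 1 c; last first.
  exists t => e j; rewrite inE => /predU1P[->|]; last exact: ht.
  by rewrite ltNge c_le1.
have [J hJ] := expr_ge_bound K c_gt1.
exists ([seq c ^+ j | j <- iota 0 J] ++ t) => e j.
rewrite inE mem_cat => /predU1P[->|e_s] e_gt1 e_lt; last by rewrite ht ?orbT.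
rewrite map_f // mem_iota add0n /= ltnNge.
by apply/negP => /hJ; rewrite leNgt e_lt.
Qed.

(** The element [g] is counted below [h] but not below itself. The count serves as the induction
    measure on powers of generators. *)
Lemma count_lt_ltn (disp : Order.disp_t) (T : orderType disp) (t : seq T)
    (g h : T) : g \in t -> (g < h)%O ->
  (count (fun x => x < g)%O t < count (fun x => x < h)%O t)%N.
Proof.
move=> gt lt_gh; elim: t gt => //= e t IHt; rewrite inE => /predU1P[<-|/IHt].
  rewrite ltxx lt_gh add0n ltnS; apply: sub_count => x /lt_trans; exact.
have [lt_eg|] := ltP e g; first by rewrite (lt_trans lt_eg lt_gh) ltn_add2l.
by case: (e < h)%O => _ lt_c; rewrite ?add0n // add1n ltnS ltnW.
Qed.

Lemma atomic_one_proper (C : {fset rat}) (a d : nat) (b := a%:R / d%:R : rat) :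
  (1 < a)%N -> (a < d)%N -> coprime a d -> b \in C ->
  (forall c, c \in C -> c = b \/ 1 <= c) -> atomic (multicyclic C).
Proof.
move=> a_gt1 lt_ad cad bC C_ge1.
have d_gt0 : (0 < d)%N by lia.
have b_gt0 : 0 < b by rewrite divr_gt0 ?ltr0n //; lia.
have b_lt1 : b < 1 by rewrite ltr_pdivrMr ?ltr0n // mul1r ltr_nat.
have C_ge0 c : c \in C -> 0 <= c by move=> /C_ge1 [->|]; lra.
have bX_atom k : atoms (multicyclic C) (b ^+ k).
  split; [exact: multicyclicX|by apply/eqP; rewrite gt_eqF ?exprn_gt0|].
  have bL j : local_ideal a j (b ^+ j).
    by rewrite -[j in local_ideal _ j _]mul1n;
      apply/local_idealX/local_ideal_frac; rewrite // expn1.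
  (* Powers of the other generators are at least 1, so below [b ^+ k] only the [b ^+ j] with [j > k]
     remain. Thus a splitting of [b ^+ k] would make [a ^ k.+1] divide [a ^ k]. *)
  have small x : multicyclic C x -> x < b ^+ k -> local_ideal a k.+1 x.
    apply: multicyclic_lt => //; first exact: local_ideal_submonoid.
    move=> c j /C_ge1 [->|c_ge1].
      rewrite ltr_iXn2l // => lt_kj; exact: (local_ideal_le lt_kj).
    rewrite ltNge (le_trans _ (exprn_ege1 _ _)) // exprn_ile1 //; exact: ltW.
  move=> [x [y [hx hy /eqP x_neq0 /eqP y_neq0 xyE]]].
  have x_gt0 : 0 < x by rewrite lt_def x_neq0 (multicyclic_ge0 C_ge0 hx).
  have y_gt0 : 0 < y by rewrite lt_def y_neq0 (multicyclic_ge0 C_ge0 hy).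
  have : local_ideal a k.+1 (b ^+ k).
    by rewrite xyE; apply: (local_ideal_submonoid _ _).2; apply: small => //;
      rewrite xyE; lra.
  rewrite expr_div_n -!natrX => /local_ideal_frac_dvdn.
  rewrite expn_gt0 d_gt0 => /(_ isT) /dvdn_leq.
  by rewrite expn_gt0 leq_exp2l // ltnn (ltnW a_gt1) => /(_ isT).
have genA := gen_submonoid_submonoid (atoms (multicyclic C)).
apply: atomicP; first exact: multicyclic_submonoid.
have gen1 : gen_submonoid (atoms (multicyclic C)) 1.
  by rewrite -(expr0 b); apply: sub_gen_submonoid.
suff gtX c j : c \in C -> 1 < c -> gen_submonoid (atoms (multicyclic C)) (c ^+ j).
  apply: multicyclic_sub => // c j cC.
  have [->|] := C_ge1 _ cC; first exact: sub_gen_submonoid.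
  by rewrite le_eqVlt => /predU1P[<-|]; [rewrite expr1n|exact: gtX].
move=> cC c_gt1; have [t ht] := finite_powers_lt C (c ^+ j + 1).
have : c ^+ j < c ^+ j + 1 by lra.
(* The bound becomes a fixed [K], so that the same list [t] serves throughout the induction on the
   number of its entries below [c ^+ j]. *)
move: (c ^+ j + 1) ht => K ht.
have [m] := ubnP (count (fun h => h < c ^+ j) t).
elim: m c j cC c_gt1 => // m IHm c j cC c_gt1 le_m lt_K.
have small x : multicyclic C x -> x < c ^+ j ->
    gen_submonoid (atoms (multicyclic C)) x.
  apply: multicyclic_lt => // e i eC lt_ec.
  have [->|] := C_ge1 _ eC; first exact: sub_gen_submonoid.
  rewrite le_eqVlt => /predU1P[<-|e_gt1]; first by rewrite expr1n.
  have lt_eK := lt_trans lt_ec lt_K.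
  apply: IHm => //; rewrite -ltnS; apply: leq_ltn_trans le_m.
  by apply: count_lt_ltn => //; apply: ht.
have [g_atom|g_natom] := EM (atoms (multicyclic C) (c ^+ j)).
  exact: sub_gen_submonoid.
(* Both summands in a splitting of [c ^+ j] are smaller, hence generated by atoms by [small]; if
   [c ^+ j] were not generated, it would be an atom. *)
apply: contrapT => gNgen; apply: g_natom; split; first exact: multicyclicX.
  by apply/eqP; rewrite gt_eqF // exprn_gt0 // (lt_trans ltr01).
move=> [x [y [hx hy /eqP x_neq0 /eqP y_neq0 xyE]]]; apply: gNgen.
have x_gt0 : 0 < x by rewrite lt_def x_neq0 (multicyclic_ge0 C_ge0 hx).
have y_gt0 : 0 < y by rewrite lt_def y_neq0 (multicyclic_ge0 C_ge0 hy).
by rewrite xyE; apply: genA.2; apply: small; rewrite // xyE; lra.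
Qed.

(** * Nonatomic monoids with at least two proper fractions *)

(** The Chinese remainder theorem gives [c < m * n] with [c = 0] modulo [m] and [c = N] modulo [n];
    then [N - c] is a natural multiple of [n]. *)
Lemma coprime_sum_mul (m n N : nat) : (0 < m)%N -> (0 < n)%N -> coprime m n ->
  (m * n <= N)%N -> exists s t, N = (s * m + t * n)%N.
Proof.
move=> m_gt0 n_gt0 cmn le_N; pose c := (chinese m n 0 N %% (m * n))%N.
have /dvdnP [s cE] : (m %| c)%N.
  by rewrite /dvdn /c modn_dvdm ?dvdn_mulr // chinese_modl // mod0n.
have le_cN : (c <= N)%N.
  by apply: leq_trans le_N; rewrite ltnW // ltn_mod muln_gt0 m_gt0.
have /dvdnP [t NcE] : (n %| N - c)%N.
  by rewrite -eqn_mod_dvd // /c modn_dvdm ?dvdn_mull // chinese_modr.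
by exists s, t; rewrite -cE -NcE subnKC.
Qed.

Definition divisible_generators (p : nat) (E : seq nat) : seq rat :=
  [:: 2 / p%:R, 3 / p%:R & [seq 6 / e%:R | e <- E]].

Definition divisible_monoid (p : nat) (E : seq nat) : set rat :=
  multicyclic [fset x in divisible_generators p E]%fset.

(** The bound 36 is [4 * 9], giving [4 ^ k * 9 ^ k <= p ^ k]; [6 < e] makes [6 / e] proper and in
    lowest terms, and [e < p] keeps [p] out of [E]. *)
Definition admissible (p : nat) (E : seq nat) : Prop :=
  [/\ prime p, (36 < p)%N, uniq E &
    forall e, e \in E -> [/\ prime e, (6 < e)%N & (e < p)%N]].

Lemma divisible_generatorsP p E x :
  x \in divisible_generators p E ->
  [\/ x = 2%:R / p%:R, x = 3%:R / p%:R | exists2 e, e \in E & x = 6%:R / e%:R].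
Proof.
rewrite !inE => /or3P[/eqP-> |/eqP->|/mapP [e eE ->]].
- by constructor 1.
- by constructor 2.
- by constructor 3; exists e.
Qed.

Lemma prime_coprime_neq (p q : nat) : prime p -> prime q -> p != q -> coprime p q.
Proof. by move=> pp pq; rewrite prime_coprime // dvdn_prime2. Qed.

Lemma coprime6_prime p : prime p -> (6 < p)%N ->
  [/\ coprime p 2, coprime p 3 & coprime p 6].
Proof.
move=> pp p_gt6; have c2 : coprime p 2 by rewrite prime_coprime_neq //; apply/eqP; lia.
have c3 : coprime p 3 by rewrite prime_coprime_neq //; apply/eqP; lia.
by split=> //; rewrite (coprimeMr p 2 3) c2.
Qed.

Section DivisibleMonoid.
Variables (p : nat) (E : seq nat).
Hypothesis pE : admissible p E.

Let p_prime : prime p. Proof. by case: pE. Qed.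
Let p_gt0 : (0 < p)%N. Proof. exact: prime_gt0. Qed.
Let p_gt36 : (36 < p)%N. Proof. by case: pE. Qed.
Let p_gt6 : (6 < p)%N. Proof. exact: ltn_trans p_gt36. Qed.
Let e_prime e : e \in E -> prime e. Proof. by case: pE => _ _ _ h /h []. Qed.
Let e_gt6 e : e \in E -> (6 < e)%N. Proof. by case: pE => _ _ _ h /h []. Qed.
Let e_ltp e : e \in E -> (e < p)%N. Proof. by case: pE => _ _ _ h /h []. Qed.
Let e_gt0 e : e \in E -> (0 < e)%N. Proof. by move/e_prime/prime_gt0. Qed.

Lemma divisible_generators_frac x : x \in divisible_generators p E ->
  exists a d : nat, [/\ (1 < a)%N, (a < d)%N, coprime d a & x = a%:R / d%:R].
Proof.
move=> /divisible_generatorsP [->|->|[e eE ->]].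
- by exists 2%N, p; have [] := coprime6_prime p_prime p_gt6; split=> //; lia.
- by exists 3%N, p; have [] := coprime6_prime p_prime p_gt6; split=> //; lia.
- by exists 6%N, e; have [] := coprime6_prime (e_prime eE) (e_gt6 eE);
    split=> //; apply: e_gt6.
Qed.

Lemma divisible_generators_proper x : x \in divisible_generators p E ->
  proper_fraction x.
Proof.
move=> /divisible_generators_frac [a [d [a_gt1 lt_ad _ ->]]].
have d_gt0 : 0 < d%:R :> rat by rewrite ltr0n; lia.
apply/andP; split; last by rewrite ltr_pdivrMr // mul1r ltr_nat.
by rewrite divr_gt0 // ltr0n ltnW.
Qed.

Lemma divisible_generators_nunit x : x \in divisible_generators p E ->
  ~ unit_fraction x.
Proof.
move=> /divisible_generators_frac [a [d [a_gt1 lt_ad cda ->]]] [m [m_gt1 /eqP]].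
rewrite -[m%:R^-1]mul1r eqr_div ?pnatr_eq0; [|lia|lia].
rewrite mul1r -natrM eqr_nat => /eqP dE.
by move: cda; rewrite -dE coprimeMl /coprime gcdnn; lia.
Qed.

(** Ensures that the finite set of generators has as many elements as the list. *)
Lemma divisible_generators_uniq : uniq (divisible_generators p E).
Proof.
have frac_inj (a b c d : nat) : (0 < c)%N -> (0 < d)%N ->
    (a%:R / c%:R == b%:R / d%:R :> rat) = (a * d == b * c)%N.
  by move=> c_gt0 d_gt0; rewrite eqr_div ?pnatr_eq0 -?lt0n // -!natrM eqr_nat.
rewrite /= !inE negb_or; apply/and3P; split.
- apply/andP; split; first by rewrite (frac_inj 2 3) // eqn_mul2r; lia.
  apply/mapP => -[e eE /eqP]; rewrite (frac_inj 2 6 _ _ p_gt0 (e_gt0 eE)).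
  by have := e_ltp eE; lia.
- apply/mapP => -[e eE /eqP]; rewrite (frac_inj 3 6 _ _ p_gt0 (e_gt0 eE)).
  by have := e_ltp eE; lia.
rewrite map_inj_in_uniq; first by case: pE.
move=> e e' eE e'E /eqP; rewrite (frac_inj 6 6 _ _ (e_gt0 eE) (e_gt0 e'E)); lia.
Qed.

Lemma divisible_generators_ge0 x :
  x \in [fset x in divisible_generators p E]%fset -> 0 <= x.
Proof. by rewrite in_fset => /divisible_generators_proper /andP[/ltW]. Qed.

Lemma divisible_monoid_invX k : divisible_monoid p E (p%:R ^- k).
Proof.
have [s [t pkE]] : exists s t, (p ^ k = s * 2 ^ (2 * k) + t * 3 ^ (2 * k))%N.
  apply: coprime_sum_mul; rewrite ?expn_gt0 //.
    by apply: coprimeXl; apply: coprimeXr.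
  rewrite -expnMn expnM; case: k => // k; rewrite leq_exp2r //; lia.
have pE_rat : p%:R ^+ k = s%:R * 2 ^+ (2 * k) + t%:R * 3 ^+ (2 * k) :> rat.
  by rewrite -!natrX -!natrM -natrD -pkE.
(* This is [p ^ k = s 4 ^ k + t 9 ^ k] divided by [p ^ (2 k)]. *)
have -> : p%:R ^- k = (2 / p%:R) ^+ (2 * k) *+ s + (3 / p%:R) ^+ (2 * k) *+ t :> rat.
  have pX_neq0 : p%:R ^+ k != 0 :> rat by rewrite expf_neq0 // pnatr_eq0 -lt0n.
  rewrite !expr_div_n -(mulr_natl _ s) -(mulr_natl _ t) !mulrA -mulrDl -pE_rat.
  by rewrite mul2n -addnn exprD; field.
have M_sub := multicyclic_submonoid [fset x in divisible_generators p E]%fset.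
by apply: M_sub.2; apply: (submonoidMn _ M_sub); apply: multicyclicX;
  rewrite in_fset !inE eqxx ?orbT.
Qed.

Lemma divisible_monoid_local (q : nat) : prime q -> (3 < q)%N -> q != p ->
   q \notin E -> divisible_monoid p E `<=` local_ideal q 0.
Proof.
move=> q_prime q_gt3 q_neqp qE.
apply: multicyclic_sub; first exact: local_ideal_submonoid.
move=> b k; rewrite in_fset => hb; apply: (@local_idealX _ 0).
have [->|->|[e eE ->]] := divisible_generatorsP hb.
- by apply: local_ideal_frac; rewrite // prime_coprime_neq.
- by apply: local_ideal_frac; rewrite // prime_coprime_neq.
apply: local_ideal_frac; rewrite ?(e_gt0 eE) //.
by apply: prime_coprime_neq (e_prime eE) _ => //; apply: contraNneq qE => ->.
Qed.

Lemma divisible_monoid_nonatomic : ~ atomic (divisible_monoid p E).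
Proof.
move=> M_atomic; have := divisible_monoid_invX 1; rewrite M_atomic => hp.
suff : local_ideal p 0 (1%:R / p%:R).
  by move=> /local_ideal_den; rewrite coprimen1 => /(_ p_gt0 isT); lia.
rewrite mul1r -[p%:R]expr1; move: hp.
apply: gen_submonoid_sub; first exact: local_ideal_submonoid.
move=> x x_atom; have [c [k [hc xE]]] := atoms_gen_submonoid x_atom.
have M_sub := multicyclic_submonoid [fset x in divisible_generators p E]%fset.
(* With [y = a ^ k / p ^ (k + 1)], the power [(a / p) ^ k] equals [p y = y + (p - 1) y], so it is
   not an atom. Only powers of the [6 / e] are left, and these lie in [Z_(p)], unlike [1 / p]. *)
have frac_atom (a : nat) : (0 < a)%N -> c = a%:R / p%:R -> local_ideal p 0 x.
  move=> a_gt0 cE; case: x_atom => _ _ []; pose y : rat := p%:R ^- k.+1 *+ a ^ k.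
  have y_gt0 : 0 < y.
    by rewrite pmulrn_lgt0 ?expn_gt0 ?a_gt0 // invr_gt0 exprn_gt0 ?ltr0n.
  have hy : divisible_monoid p E y.
    by apply: (submonoidMn _ M_sub); apply: divisible_monoid_invX.
  exists y, (y *+ p.-1); split=> //.
  - exact: (submonoidMn _ M_sub).
  - by apply/eqP; rewrite gt_eqF.
  - by apply/eqP; rewrite gt_eqF // pmulrn_lgt0 //; lia.
  rewrite -mulrS prednK // xE cE expr_div_n -natrX.
  rewrite -(mulr_natl y p) /y -(mulr_natl (_^-1)) exprS.
  have p_neq0 : p%:R != 0 :> rat by rewrite pnatr_eq0 -lt0n.
  by field; rewrite expf_neq0.
move: hc; rewrite in_fset.
move=> /divisible_generatorsP[||[e eE cE]]; try exact: frac_atom.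
rewrite xE; apply: (@local_idealX _ 0); rewrite cE.
apply: local_ideal_frac; rewrite ?(e_gt0 eE) //.
by apply: prime_coprime_neq (e_prime eE) _ => //; rewrite gtn_eqF ?e_ltp.
Qed.

Lemma divisible_monoid_primitive :
  primitive_generators [fset x in divisible_generators p E]%fset.
Proof.
set C := [fset _ in _]%fset; split.
  by move=> b; rewrite in_fset => /divisible_generators_proper /andP[].
move=> B' ltB'; have sB' := fsubsetP (fproper_sub ltB').
have sM : multicyclic B' `<=` multicyclic C.
  apply: multicyclic_sub; first exact: multicyclic_submonoid.
  by move=> b k /sB'; exact: multicyclicX.
have [c cC cNB'] : exists2 c, c \in C & c \notin B'.
  by move: ltB'; rewrite fproperE => /andP[_ /fsubsetPn].
rewrite properEneq; split=> //; apply/eqP => eqM.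
have hc : multicyclic B' c by rewrite eqM -[c]expr1; exact: multicyclicX.
have B'_ge0 b : b \in B' -> 0 <= b by move=> /sB' /divisible_generators_ge0.
(* Here [m] divides the numerators of all remaining generators but not that of [c]. As [c < 1], the
   power [b ^+ 0 = 1], not divisible by [m], cannot occur in a sum equal to [c]. *)
have den_case (m a : nat) : (1 < m)%N -> ~~ (m %| a)%N -> c = a%:R / p%:R ->
    (forall b, b \in B' -> local_ideal m 1 b) -> False.
  move=> m_gt1 mNa cE hL.
  have : local_ideal m 1 c.
    apply: (multicyclic_lt (local_ideal_submonoid m 1) B'_ge0 _ hc (r := 1)).
    - move=> b [|k] bB' lt1; first by rewrite expr0 ltxx in lt1.
      apply: (@local_ideal_le _ _ (1 * k.+1)) => //; apply: local_idealX; exact: hL.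
    - by move: cC; rewrite in_fset => /divisible_generators_proper /andP[].
  by rewrite cE => /(local_ideal_frac_dvdn p_gt0); rewrite expn1; apply/negP.
have [c2p c3p _] := coprime6_prime p_prime p_gt6.
have := cC; rewrite in_fset => /divisible_generatorsP[cE|cE|[e eE cE]].
- apply: (den_case 3 2) => // b bB'.
  have := sB' _ bB'; rewrite in_fset => /divisible_generatorsP[bE|->|[e eE ->]].
  + by rewrite -cE in bE; rewrite bE (negPf cNB') in bB'.
  + by apply: local_ideal_frac; rewrite // coprime_sym.
  + have [_ c3 _] := coprime6_prime (e_prime eE) (e_gt6 eE).
    by apply: local_ideal_frac; rewrite ?(e_gt0 eE) // coprime_sym.
- apply: (den_case 2 3) => // b bB'.
  have := sB' _ bB'; rewrite in_fset => /divisible_generatorsP[->|bE|[e eE ->]].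
  + by apply: local_ideal_frac; rewrite // coprime_sym.
  + by rewrite -cE in bE; rewrite bE (negPf cNB') in bB'.
  + have [c2 _ _] := coprime6_prime (e_prime eE) (e_gt6 eE).
    by apply: local_ideal_frac; rewrite ?(e_gt0 eE) // coprime_sym.
(* For [c = 6 / e], all other denominators are coprime to [e], so the remaining generators stay in
   [Z_(e)], which does not contain [c]. *)
have [e2 e3 e6] := coprime6_prime (e_prime eE) (e_gt6 eE).
suff : local_ideal e 0 c.
  by rewrite cE => /(local_ideal_den (e_gt0 eE) e6); have := e_gt6 eE; lia.
have ep : coprime e p by rewrite prime_coprime_neq ?(e_prime eE) // ltn_eqF ?e_ltp.
move: hc; apply: multicyclic_sub; first exact: local_ideal_submonoid.
move=> b k bB'; apply: (@local_idealX _ 0).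
have := sB' _ bB'; rewrite in_fset => /divisible_generatorsP[->|->|[e' e'E bE]].
- exact: local_ideal_frac.
- exact: local_ideal_frac.
rewrite bE; apply: local_ideal_frac; rewrite ?(e_gt0 e'E) //.
apply: prime_coprime_neq (e_prime eE) (e_prime e'E) _.
by apply: contraNneq cNB' => ee'; rewrite cE ee' -bE.
Qed.

End DivisibleMonoid.

(** Since [f 1 = p ^ k f (p ^- k)] and the target lies in [Z_(p)], the image of 1 is divisible by
    all powers of [p]. It is therefore 0, against injectivity. *)
Lemma divisible_monoid_not_isomorphic (p q : nat) (E : seq nat) :
  admissible p E -> admissible q E -> p <> q ->
  ~ monoid_isomorphic (divisible_monoid p E) (divisible_monoid q E).
Proof.
move=> pE qE /eqP p_neq_q [f [[f_fun f_inj _] f0 fD]].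
have [p_prime p_gt36 _ E_lt] := pE.
have p_neq0 k : p%:R ^+ k != 0 :> rat by rewrite expf_neq0 // pnatr_eq0; lia.
pose C r := [fset x in divisible_generators r E]%fset.
have fMn x n : divisible_monoid p E x -> f (x *+ n) = f x *+ n.
  move=> hx; elim: n => [|n IHn]; first by rewrite !mulr0n.
  rewrite !mulrS fD ?IHn //; exact: (submonoidMn _ (multicyclic_submonoid (C p))).
have M1 : divisible_monoid p E 1.
  by have := divisible_monoid_invX pE 0; rewrite expr0 invr1.
suff f1 : f 1 = 0.
  suff : 1 = 0 :> rat by move/eqP; rewrite oner_eq0.
  apply: f_inj; rewrite ?f0 // inE //.
  exact: (multicyclic_submonoid (C p)).1.
apply: (@local_ideal_eq0 p) => [|| k]; first exact: prime_gt1.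
  by apply: (multicyclic_ge0 (B := C q));
    [exact: divisible_generators_ge0|exact: f_fun].
have -> : f 1 = (p ^ k)%:R * f (p%:R ^- k).
  rewrite mulr_natl -fMn; last exact: divisible_monoid_invX.
  by congr f; rewrite -(mulr_natl (_^-1)) natrX divff.
rewrite -[k in local_ideal _ k]addn0; apply: local_idealM.
  rewrite -[(p ^ k)%:R]divr1; apply: (@local_ideal_frac _ _ _ 1) => //.
  exact: coprimen1.
apply: (divisible_monoid_local qE) => //; first lia; last first.
  by apply: f_fun; exact: divisible_monoid_invX.
by apply/negP => /E_lt []; rewrite ltnn.
Qed.

(** * Infinitely many isomorphism classes *)

Lemma leq_sumn_mem (s : seq nat) (x : nat) : x \in s -> (x <= sumn s)%N.
Proof. by move=> /perm_to_rem/perm_sumn ->; rewrite leq_addr. Qed.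

Lemma seq_of_primes (m : nat) : exists E : seq nat,
  [/\ uniq E, size E = m & forall e, e \in E -> prime e /\ (6 < e)%N].
Proof.
elim: m => [|m [E [uE sE hE]]]; first by exists [::].
(* The sum of [E] bounds each of its members, so [q] is new. *)
have [q lt_q q_prime] := prime_above (6 + sumn E).
have lt_Eq e : e \in E -> (e < q)%N.
  by move=> eE; apply: leq_ltn_trans lt_q;
    rewrite (leq_trans (leq_sumn_mem eE)) ?leq_addl.
exists (q :: E); split=> /=; rewrite ?sE ?uE ?andbT //.
  by apply/negP => /lt_Eq; rewrite ltnn.
by move=> e; rewrite inE => /predU1P[->|/hE //]; split=> //; lia.
Qed.

Lemma nonatomic_multicyclic_infinite (n : nat) : (2 <= n)%N ->
  infinitely_many_nonisomorphic (nonatomic_multicyclic n).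
Proof.
move=> n_ge2; have [E [uE sE hE]] := seq_of_primes (n - 2).
pose next m := s2val (prime_above m).
(* The exponent [k.+1] makes already [q 0] a prime above the starting bound. *)
pose q k := iter k.+1 next (36 + sumn E).
have nextP m : (m < next m)%N /\ prime (next m).
  by split; [exact: (s2valP (prime_above m))|exact: (s2valP' (prime_above m))].
have q_gt k : (36 + sumn E < q k)%N.
  elim: k => [|k IHk]; first exact: (nextP _).1.
  by apply: ltn_trans IHk _; exact: (nextP _).1.
have q_adm k : admissible (q k) E.
  split=> //; first exact: (nextP _).2; first by have := q_gt k; lia.
  move=> e eE; have [? ?] := hE _ eE; split=> //.
  by apply: leq_ltn_trans (q_gt k); rewrite (leq_trans (leq_sumn_mem eE)) ?leq_addl.
have q_inj k l : q k = q l -> k = l.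
  have q_mono : {homo q : i j / (i < j)%N}.
    by apply: homo_ltn => [? ? ?|i]; [exact: ltn_trans|exact: (nextP _).1].
  by case: (ltngtP k l) => // /q_mono; lia.
pose M k := divisible_monoid (q k) E.
have M_niso k l : k <> l -> ~ monoid_isomorphic (M k) (M l).
  by move=> kl; apply: divisible_monoid_not_isomorphic => // /q_inj.
exists (range M); split.
- move=> _ [k _ <-]; split; first exact: divisible_monoid_nonatomic.
  exists [fset x in divisible_generators (q k) E]%fset; split=> //.
  + exact: divisible_monoid_primitive.
  + by move=> c; rewrite in_fset; exact: divisible_generators_nunit.
  set C := [fset x in divisible_generators (q k) E]%fset.
  have -> : [fset c in C | proper_fraction c]%fset = C.
    apply/fsetP => c; rewrite !in_fset inE /= in_fset.
    by apply: andb_idr; exact: divisible_generators_proper.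
  rewrite card_fseq undup_id; last exact: divisible_generators_uniq.
  by rewrite /= size_map sE; lia.
- move=> fin_M; apply: infinite_nat.
  apply: sub_finite_set (finite_preimage _ fin_M); first by move=> k _; exists k.
  (* [M] is injective: equal monoids are isomorphic through the identity. *)
  move=> k l _ _ MkE; apply: contrapT => /M_niso []; exists id; split=> //.
  by rewrite MkE; split=> // x; exists x.
- by move=> _ _ [k _ <-] [l _ <-] MkNl; apply: M_niso => kl; rewrite kl in MkNl.
Qed.

(** With no proper fraction all generators are at least 1; with exactly one, [atomic_one_proper]
    applies. *)
Lemma nonatomic_multicyclic_lt2 (n : nat) (M : set rat) : (n < 2)%N ->
  ~ nonatomic_multicyclic n M.
Proof.
move=> n_lt2 [M_natomic [C [ME [C_gt0 _] C_nunit C_card]]]; apply: M_natomic.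
rewrite ME; set P := [fset _ in _ | _]%fset in C_card.
have P_mem c : c \in P = (c \in C) && proper_fraction c by rewrite !inE.
have C_ge1 c : c \in C -> c \notin P -> 1 <= c.
  by move=> cC; rewrite P_mem cC /= /proper_fraction C_gt0 //= -leNgt.
case: n n_lt2 C_card => [_ /eqP|[_ /eqP/cardfs1P[b Pb]|//]].
  rewrite cardfs_eq0 => /eqP P0; apply: (@hereditarily_atomic_multicyclic C).
  - by move=> c cC; apply: C_ge1; rewrite ?P0 ?inE.
  - exact: multicyclic_submonoid.
  - by [].
have : b \in P by rewrite Pb inE.
rewrite P_mem => /andP[bC /proper_frac_nat/(_ (C_nunit _ bC))].
move=> [a [d [a_gt1 lt_ad cad bE]]]; rewrite bE in bC Pb.
apply: (atomic_one_proper a_gt1 lt_ad cad bC) => c cC.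
have [|cP] := boolP (c \in P); last by right; exact: C_ge1.
by rewrite Pb inE => /eqP; left.
Qed.

Theorem theorem3p7 (B : {fset rat}) (n : nat)
    (hB : primitive_generators B)
    (hunit : forall b : rat, b \in B -> ~ unit_fraction b) :
  (hereditarily_atomic (multicyclic B) <->
     (forall b : rat, b \in B -> denq b <= numq b)) /\
  (infinitely_many_nonisomorphic (nonatomic_multicyclic n) <-> (2 <= n)%N).
Proof.
have num_le_den (b : rat) : (denq b <= numq b) = (1 <= b).
  rewrite -{3}[b]divq_num_den ler_pdivlMr ?mul1r ?ler_int //.
  by rewrite ltr0z denq_gt0.
split; split.
- move=> M_hatomic b bB; rewrite num_le_den leNgt; apply/negP => b_lt1.
  have b_proper : proper_fraction b by rewrite /proper_fraction hB.1.
  have [a [d [a_gt1 lt_ad cad bE]]] := proper_frac_nat b_proper (hunit _ bB).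
  have [|k|N [hN NM []]] :=
    nonatomic_submonoid_frac (M := multicyclic B) a_gt1 lt_ad cad.
  + exact: multicyclic_submonoid.
  + by rewrite -bE; exact: multicyclicX.
  + exact: M_hatomic.
- move=> B_ge1; apply: hereditarily_atomic_multicyclic => b /B_ge1.
  by rewrite num_le_den.
(* One member of the infinite family already gives a contradiction. *)
- move=> [F [FP F_inf _]]; rewrite leqNgt; apply/negP => n_lt2.
  have [M FM] := infinite_setN0 F_inf.
  exact: nonatomic_multicyclic_lt2 n_lt2 (FP _ FM).
- exact: nonatomic_multicyclic_infinite.
Qed.
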